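(* Let $I=\{1,\dots,\ell\}$, $J=\{\ell+1,\dots,p\}$, let $h_1,\dots,h_p\colon\mathbb R^n\times\mathbb R^m\to\overline{\mathbb R}$ and $\Gamma(x):=\{y\in\mathbb R^m\mid h_i(x,y)\le0\ (i\in I),\ h_i(x,y)=0\ (i\in J)\}$. Fix $\bar x\in\operatorname{dom}\Gamma$. Assume that $h_1,\dots,h_p$ are continuous and continuously differentiable with respect to $y$ in a neighborhood of $\{\bar x\}\times\Gamma(\bar x)$, that $h_i(x,\cdot)\colon\mathbb R^m\to\mathbb R$ is continuous for every $x\in\operatorname{dom}\Gamma$ and every $i$, and assume (A1): for each $x\in\mathbb R^n$, $h_i(x,\cdot)$ is convex for $i\in I$ and affine for $i\in J$; and (A2): $\Gamma$ is locally bounded at $\bar x$. Suppose that RCPLD holds with respect to $\operatorname{dom}\Gamma$ at each point of $\{\bar x\}\times\Gamma(\bar x)$. Then $\Gamma$ is R-regular with respect to $\operatorname{dom}\Gamma$ at each point of $\{\bar x\}\times\Gamma(\bar x)$.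
   Context: $\operatorname{dom}\Gamma:=\{x\mid\Gamma(x)\ne\emptyset\}$; $\operatorname{dist}(y,A):=\inf_{z\in A}\|z-y\|$ (Euclidean norm). $\Gamma$ is locally bounded at $\bar x$ if there are a bounded set $B$ and a neighborhood $V$ of $\bar x$ with $\Gamma(x)\subset B$ for all $x\in V$. $\Gamma$ is R-regular at $(\bar x,\bar y)$ with respect to $\Omega$ if there exist $\kappa>0$ and a neighborhood $U$ of $(\bar x,\bar y)$ such that $\operatorname{dist}(y,\Gamma(x))\le\kappa\max\{0,\max_{i\in I}h_i(x,y),\max_{i\in J}|h_i(x,y)|\}$ for all $(x,y)\in U\cap(\Omega\times\mathbb R^m)$. A pair of finite families $((a^i)_{i\in I_1},(b^i)_{i\in I_2})$ is positive-linearly dependent if there are scalars $\alpha_i\ge0$ ($i\in I_1$), $\beta_i$ ($i\in I_2$), not all zero, with $\sum\alpha_ia^i+\sum\beta_ib^i=0$. For $(\bar x,\bar y)\in\operatorname{gph}\Gamma$ let $I(\bar x,\bar y):=\{i\in I\mid h_i(\bar x,\bar y)=0\}$. RCPLD holds at $(\bar x,\bar y)$ with respect to $\Omega\subset\mathbb R^n$ if there are a neighborhood $U$ of $(\bar x,\bar y)$ and an index set $S\subset J$ such that: (i) $\{\nabla_yh_i(\bar x,\bar y)\mid i\in S\}$ is a basis of the span of $\{\nabla_yh_i(\bar x,\bar y)\mid i\in J\}$; (ii) the family $(\nabla_yh_i(x,y))_{i\in J}$ has constant rank on $U\cap(\Omega\times\mathbb R^m)$; (iii) for each $K\subset I(\bar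 x,\bar y)$ such that the pair $((\nabla_yh_i(\bar x,\bar y))_{i\in K},(\nabla_yh_i(\bar x,\bar y))_{i\in S})$ is positive-linearly dependent, the family $(\nabla_yh_i(x,y))_{i\in K\cup S}$ is linearly dependent for each $(x,y)\in U\cap(\Omega\times\mathbb R^m)$. *)

(* Defs.v *)
From HB Require Import structures.
From mathcomp Require Import all_boot all_order all_algebra.
From mathcomp Require Import all_classical all_reals all_analysis.
Set Implicit Arguments. Unset Strict Implicit. Unset Printing Implicit Defensive.
Import Order.TTheory GRing.Theory Num.Theory.
Import numFieldNormedType.Exports.
Local Open Scope classical_set_scope.
Local Open Scope ring_scope.

Section Defs.
Variables (R : realType) (n m p l : nat).
(* h i x y = h_{i+1}(x,y); I = {i | i < l}, J = {i | l <= i < p} *)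
Variable h : 'I_p -> 'rV[R]_n -> 'rV[R]_m -> \bar R.

Definition enorm (v : 'rV[R]_m) : R := Num.sqrt (\sum_(j < m) v 0 j ^+ 2).

(* dist(y, A) = inf_{z in A} ||z - y||  (= +oo if A is empty) *)
Definition edist (y : 'rV[R]_m) (A : set 'rV[R]_m) : \bar R :=
  ereal_inf [set (enorm (z - y))%:E | z in A].

Definition Gam (x : 'rV[R]_n) : set 'rV[R]_m :=
  [set y | (forall i : 'I_p, (i < l)%N -> (h i x y <= 0)%E) /\
           (forall i : 'I_p, (l <= i)%N -> h i x y = 0%E)].

Definition domG : set 'rV[R]_n := [set x | Gam x !=set0].

Definition locally_bounded_at (xbar : 'rV[R]_n) : Prop :=
  exists (B : set 'rV[R]_m) (M : R), (forall y, B y -> enorm y <= M) /\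
  exists V : set 'rV[R]_n, nbhs xbar V /\ forall x, V x -> Gam x `<=` B.

Definition viol (x : 'rV[R]_n) (y : 'rV[R]_m) : \bar R :=
  \big[maxe/0%E]_(i < p) (if (i < l)%N then h i x y else `|h i x y|%E).

Definition Rregular (Om : set 'rV[R]_n) (xbar : 'rV[R]_n) (ybar : 'rV[R]_m) : Prop :=
  exists (kappa : R), 0 < kappa /\
  exists U : set ('rV[R]_n * 'rV[R]_m), nbhs (xbar, ybar) U /\
  forall x y, U (x, y) -> Om x -> (edist y (Gam x) <= kappa%:E * viol x y)%E.

Definition grad (i : 'I_p) (x : 'rV[R]_n) (y : 'rV[R]_m) : 'rV[R]_m :=
  \row_(j < m) ('d (fun z : 'rV[R]_m => fine (h i x z)) y) (delta_mx 0 j).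

Definition lin_dep (v : 'I_p -> 'rV[R]_m) (K : {set 'I_p}) : Prop :=
  exists c : 'I_p -> R, (exists2 i, i \in K & c i != 0) /\
    \sum_(i in K) c i *: v i = 0.

Definition is_basis_of_span (v : 'I_p -> 'rV[R]_m) (S T : {set 'I_p}) : Prop :=
  S \subset T /\ ~ lin_dep v S /\
  forall j, j \in T -> exists c : 'I_p -> R, v j = \sum_(i in S) c i *: v i.

Definition pos_lin_dep (a : 'I_p -> 'rV[R]_m) (K : {set 'I_p})
    (b : 'I_p -> 'rV[R]_m) (S : {set 'I_p}) : Prop :=
  exists alpha beta : 'I_p -> R,
    (forall i, i \in K -> 0 <= alpha i) /\
    ((exists2 i, i \in K & alpha i != 0) \/ (exists2 i, i \in S & beta i != 0)) /\
    \sum_(i in K) alpha i *: a i + \sum_(i in S) beta i *: b i = 0.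

Definition Jset : {set 'I_p} := [set i : 'I_p | (l <= i)%N].

Definition active (x : 'rV[R]_n) (y : 'rV[R]_m) : {set 'I_p} :=
  [set i : 'I_p | (i < l)%N && (h i x y == 0%E)].

Definition rankJ (x : 'rV[R]_n) (y : 'rV[R]_m) : nat :=
  \rank (\matrix_(i < p) (if (l <= i)%N then grad i x y else 0)).

Definition RCPLD (Om : set 'rV[R]_n) (xbar : 'rV[R]_n) (ybar : 'rV[R]_m) : Prop :=
  exists (U : set ('rV[R]_n * 'rV[R]_m)) (S : {set 'I_p}),
    nbhs (xbar, ybar) U /\ S \subset Jset /\
    is_basis_of_span (grad ^~ xbar ^~ ybar) S Jset /\
    (forall x y x' y', U (x, y) -> Om x -> U (x', y') -> Om x' ->
        rankJ x y = rankJ x' y') /\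
    (forall K : {set 'I_p}, K \subset active xbar ybar ->
       pos_lin_dep (grad ^~ xbar ^~ ybar) K (grad ^~ xbar ^~ ybar) S ->
       forall x y, U (x, y) -> Om x -> lin_dep (grad ^~ x ^~ y) (K :|: S)).

Definition C1y_near (xbar : 'rV[R]_n) : Prop :=
  exists W : set ('rV[R]_n * 'rV[R]_m), open W /\
    (forall y, Gam xbar y -> W (xbar, y)) /\
    forall i : 'I_p, forall q, W q ->
      h i q.1 q.2 \is a fin_num /\
      {for q, continuous (fun r : 'rV[R]_n * 'rV[R]_m => h i r.1 r.2)} /\
      differentiable (fun z : 'rV[R]_m => fine (h i q.1 z)) q.2 /\
      {for q, continuous (fun r : 'rV[R]_n * 'rV[R]_m => grad i r.1 r.2)}.

(* convexity of an extended-real-valued function (convex epigraph) *)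
Definition econvex (f : 'rV[R]_m -> \bar R) : Prop :=
  forall (y1 y2 : 'rV[R]_m) (t1 t2 lam : R), 0 <= lam <= 1 ->
    (f y1 <= t1%:E)%E -> (f y2 <= t2%:E)%E ->
    (f (lam *: y1 + (1 - lam) *: y2)%R <= (lam * t1 + (1 - lam) * t2)%:E)%E.

Definition eaffine (f : 'rV[R]_m -> \bar R) : Prop :=
  exists (a : 'rV[R]_m) (b : R), forall y, f y = (\sum_(j < m) a 0 j * y 0 j + b)%:E.

End Defs.

(* Main.v *)
Require Import Defs.
From HB Require Import structures.
From mathcomp Require Import all_boot all_order all_algebra.
From mathcomp Require Import all_classical all_reals all_analysis.
From mathcomp Require Import lra ring.
Import Order.TTheory GRing.Theory Num.Theory.
Import numFieldNormedType.Exports.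
Local Open Scope classical_set_scope.
Local Open Scope ring_scope.

(* For x in dom Gamma near xbar, let z_k minimize the penalty function
   |z - y|^2 + k sum_i s_i(z)^2, where s_i = max(0, h_i(x, .)) for i in I and
   s_i = h_i(x, .) for i in J.  Stationarity gives y - z_k as the combination of
   the gradients of h at z_k with multipliers k s_i(z_k).  By constant rank, the
   gradients indexed by J may be replaced by those indexed by S, and
   Caratheodory's argument then leaves a linearly independent family K, S, which
   by RCPLD is positive-linearly independent at a nearby point of
   {xbar} x Gamma(xbar).  Compactness turns this into a bound
   c sum|lambda_i| <= |y - z_k| for the new multipliers, uniform near
   {xbar} x Gamma(xbar).  Convexity then yields
   |y - z_k|^2 = sum lambda_i <grad h_i, y - z_k>
   <= (|y - z_k| / c) (viol(x, y) + sum_i |s_i(z_k)|), and k -> oo gives the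
   claim with kappa = 1 / c, for every y. *)

(** * Caratheodory reduction and constant rank *)

Section FiniteFamilies.
Set Implicit Arguments. Unset Strict Implicit.
Variables (R : realType) (m p : nat).
Implicit Types (v : 'I_p -> 'rV[R]_m) (c lam : 'I_p -> R) (S K : {set 'I_p}).

Lemma sum_supp v c K : (forall i, i \notin K -> c i = 0) ->
  \sum_(i in K) c i *: v i = \sum_i c i *: v i.
Proof.
move=> cK; rewrite big_mkcond; apply: eq_bigr => i _.
by case: ifPn => // /cK ->; rewrite scale0r.
Qed.

(** Coefficients extended by zero live on the whole index type, so the support can shrink or grow
    without reindexing the sum. *)
Lemma lin_depP v K : lin_dep v K <->
  exists c, [/\ forall i, i \notin K -> c i = 0, exists i, c i != 0
    & \sum_i c i *: v i = 0].
Proof.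
split=> [[c [[i iK ci0] c0]]|[c [cK [i ci0] c0]]].
  exists (fun i => if i \in K then c i else 0); split.
  - by move=> j /negPf ->.
  - by exists i; rewrite iK.
  - rewrite -(@sum_supp v _ K) => [|j /negPf -> //].
    by rewrite -[RHS]c0; apply: eq_bigr => j ->.
exists c; split; last by rewrite sum_supp.
by exists i => //; apply: contraNT ci0 => /cK ->.
Qed.

(* Subtracting from lam the largest multiple of a dependency that keeps it
   nonnegative off S kills one coordinate off S. *)
Lemma caratheodory v S lam : ~ lin_dep v S ->
  (forall i, i \notin S -> 0 <= lam i) ->
  exists lam', [/\ forall i, i \notin S -> 0 <= lam' i,
    forall i, i \notin S -> lam' i != 0 -> lam i != 0,
    \sum_i lam' i *: v i = \sum_i lam i *: v i
    & ~ lin_dep v ([set i | (i \notin S) && (lam' i != 0)]%SET :|: S)].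
Proof.
move=> Sind.
have [n] := ubnP #|[set i | (i \notin S) && (lam i != 0)]%SET|.
elim: n lam => // n IH lam; set K := [set i | _]%SET => Kn lam0.
have [|dep] := pselect (~ lin_dep v (K :|: S)); first by exists lam.
have {}dep : lin_dep v (K :|: S) by apply: contrapT.
(* Independence on [S] forces a nonzero coefficient off [S]; replacing [c] by [- c] if necessary
   makes it positive. *)
have {dep} [c [cK [i0 i0S ci0] csum]] : exists c,
    [/\ forall i, i \notin K :|: S -> c i = 0,
        exists2 i, i \notin S & 0 < c i & \sum_i c i *: v i = 0].
  move/lin_depP : dep => [c [cK [i ci] csum]].
  have [i1 i1S ci1] : exists2 i, i \notin S & c i != 0.
    apply: contrapT => cS; apply: Sind; apply/lin_depP; exists c; split => //.
      move=> j jS; apply/eqP/negPn/negP => cj.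
      by apply: cS; exists j.
    by exists i.
  have [ci10|ci10] := ltP 0 (c i1); first by exists c; split=> //; exists i1.
  exists (fun i => - c i); split.
  - by move=> j /cK ->; rewrite oppr0.
  - by exists i1 => //; rewrite oppr_gt0 lt_neqAle ci1.
  - under eq_bigr do rewrite scaleNr.
    by rewrite sumrN csum oppr0.
have P0 : (i0 \notin S) && (0 < c i0) by rewrite i0S.
pose i1 := [arg min_(i < i0 | (i \notin S) && (0 < c i)) (lam i / c i)]%O.
have [i1S ci1 i1min] : [/\ i1 \notin S, 0 < c i1 &
    forall i, i \notin S -> 0 < c i -> lam i1 / c i1 <= lam i / c i].
  rewrite /i1; case: arg_minP => // i /andP[iS ci] imin; split => // j jS cj.
  by apply: imin; rewrite jS.
pose t := lam i1 / c i1.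
have t0 : 0 <= t by rewrite divr_ge0 ?lam0 // ltW.
pose lam1 i := lam i - t * c i.
have lam1_ge0 i : i \notin S -> 0 <= lam1 i.
  move=> iS; rewrite /lam1 subr_ge0; have [ci|ci] := ltP 0 (c i).
    by rewrite -ler_pdivlMr //; exact: i1min.
  by apply: le_trans (lam0 _ iS); rewrite mulr_ge0_le0.
have lam1_supp i : i \notin S -> lam1 i != 0 -> lam i != 0.
  move=> iS; apply: contra_neq => li0; rewrite /lam1 li0 cK ?mulr0 ?subr0 //.
  by rewrite !inE li0 eqxx andbF (negPf iS).
have lam1i1 : lam1 i1 = 0 by rewrite /lam1 /t divfK ?subrr // gt_eqF.
have sum1 : \sum_i lam1 i *: v i = \sum_i lam i *: v i.
  rewrite /lam1; under eq_bigr do rewrite scalerBl -scalerA.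
  by rewrite sumrB -scaler_sumr csum scaler0 subr0.
(* The support off [S] does not grow and loses [i1], so the induction on its cardinality applies. *)
have [|//|lam' [l0 lsupp lsum lind]] := IH lam1.
  apply: leq_trans (_ : _ < #|K|)%N _; last by rewrite -ltnS.
  apply: proper_card; apply/properP; split.
    by apply/fintype.subsetP => i; rewrite !inE => /andP[iS li]; rewrite iS lam1_supp.
  exists i1; rewrite !inE ?lam1i1 ?eqxx ?andbF // i1S /=.
  apply: contraTneq ci1 => li1; rewrite cK ?ltxx //.
  by rewrite !inE li1 eqxx andbF (negPf i1S).
exists lam'; split => // [i iS /(lsupp _ iS)/(lam1_supp _ iS) //|].
by rewrite lsum.
Qed.

Definition rowmx v K : 'M[R]_(p, m) := \matrix_i (if i \in K then v i else 0).

Lemma mul_rowmx v K (u : 'rV[R]_p) :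
  u *m rowmx v K = \sum_(i in K) u 0 i *: v i.
Proof.
rewrite mulmx_sum_row [RHS]big_mkcond; apply: eq_bigr => i _.
by rewrite rowK; case: ifP => //; rewrite scaler0.
Qed.

Lemma rowmx_subP v K j : (v j <= rowmx v K)%MS <->
  exists c, v j = \sum_(i in K) c i *: v i.
Proof.
split=> [/submxP [u ->]|[c ->]]; first by exists (u 0); rewrite mul_rowmx.
apply: summx_sub => i iK; apply: scalemx_sub.
suff -> : v i = row i (rowmx v K) by apply: row_sub.
by rewrite rowK iK.
Qed.

(* By independence the rank of [v' in S] is at least that of [v in S], which
   by constancy of the rank is that of the larger family [v' in T]. *)
Lemma basis_of_span_const_rank v v' S T : is_basis_of_span v S T ->
  ~ lin_dep v' S -> \rank (rowmx v' T) = \rank (rowmx v T) ->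
  forall j, j \in T -> exists c, v' j = \sum_(i in S) c i *: v' i.
Proof.
move=> [ST [_ vspan]] ind' rk j jT; apply/rowmx_subP.
(* [D] is the coordinate projection onto [S]. Its rank stands for the cardinality of [S]: it bounds
   the rank of [v] on [S] from above and, by independence, that of [v'] on [S] from below. *)
pose D : 'M[R]_p := diag_mx (\row_i (i \in S)%:R).
have DE (u : 'rV[R]_p) i : (u *m D) 0 i = u 0 i * (i \in S)%:R.
  by rewrite mul_mx_diag !mxE.
have vTS : (rowmx v T <= rowmx v S)%MS.
  apply/row_subP => i; rewrite rowK; case: ifP => [iT|_]; last exact: sub0mx.
  by apply/rowmx_subP; exact: vspan.
have rD : (\rank (rowmx v S) <= \rank D)%N.
  rewrite (_ : rowmx v S = D *m rowmx v S) ?mxrankM_maxl //.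
  apply/row_matrixP => i; rewrite row_mul row_diag_mx !rowK mxE.
  by rewrite -scalemxAl -rowE rowK; case: ifP; rewrite ?scaler0 ?scale1r.
have Dr : (\rank D <= \rank (rowmx v' S))%N.
  have : (\rank (kermx (rowmx v' S)) <= \rank (kermx D))%N.
    apply: mxrankS; apply/rV_subP => u /sub_kermxP u0; apply/sub_kermxP.
    apply/rowP => i; rewrite DE mxE; case: (boolP (i \in S)) => iS; last by rewrite mulr0.
    rewrite mulr1; apply/eqP/negPn/negP => ui; apply: ind'; exists (u 0); split.
      by exists i.
    by rewrite -mul_rowmx.
  by rewrite !mxrank_ker leq_sub2lE ?rank_leq_row.
have v'ST : (rowmx v' S <= rowmx v' T)%MS.
  apply/row_subP => i; rewrite rowK; case: ifPn => [iS|_]; last exact: sub0mx.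
  suff -> : v' i = row i (rowmx v' T) by apply: row_sub.
  by rewrite rowK (fintype.subsetP ST).
have : (rowmx v' T <= rowmx v' S)%MS.
  rewrite -(geq_leqif (mxrank_leqif_sup v'ST)) rk.
  exact: leq_trans (leq_trans (mxrankS vTS) rD) Dr.
apply: submx_trans.
suff -> : v' j = row j (rowmx v' T) by apply: row_sub.
by rewrite rowK jT.
Qed.

End FiniteFamilies.

(** * Positive linear independence is an open condition *)

Section PositiveIndependence.
Set Implicit Arguments. Unset Strict Implicit.
Variables (R : realType) (m p : nat).
Implicit Types (S K : {set 'I_p}).

Lemma cvg_sumr (V : normedModType R) (I T : Type) (r : seq I) (P : pred I)
    (F : set_system T) {FF : Filter F} (f : I -> T -> V) (l : I -> V) :
  (forall i, P i -> f i x @[x --> F] --> l i) ->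
  \sum_(i <- r | P i) f i x @[x --> F] --> \sum_(i <- r | P i) l i.
Proof. by apply: cvg_big; exact: add_continuous. Qed.

(** The normalization confines each coordinate to [[0, 1]], [[-1, 1]] or [[0, 0]], so the set is a
    closed part of a compact box. *)
Lemma simplex_compact K S : compact [set lam : 'rV[R]_p |
  [/\ forall i, i \notin K :|: S -> lam 0 i = 0,
      forall i, i \in K -> 0 <= lam 0 i & \sum_i `|lam 0 i| = 1]].
Proof.
pose A (i : 'I_p) : set R := if i \in K then `[0, 1]%classic else
  if i \in S then `[-1, 1]%classic else `[0, 0]%classic.
have cptA : compact [set v : 'rV[R]_p | forall i, A i (v ord0 i)].
  by apply: rV_compact => i; rewrite /A; case: ifP => _; [|case: ifP => _];
    exact: segment_compact.
have clB : closed [set v : 'rV[R]_p | \sum_i `|v 0 i| = 1].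
  apply: (@preimage_closed _ _ (fun v : 'rV[R]_p => \sum_i `|v 0 i|) [set 1]).
    move=> v _; apply: (cvg_sumr (F := nbhs v)) => i _; apply: cvg_norm.
    exact: coord_continuous.
  exact: closed_eq.
rewrite (_ : mkset _ = [set v : 'rV[R]_p | forall i, A i (v ord0 i)] `&`
    [set v : 'rV[R]_p | \sum_i `|v 0 i| = 1]); first exact: compact_closedI.
apply/seteqP; split => [v [v0 vK v1]|v [vA v1]]; split => //.
- move=> i; have : `|v 0 i| <= 1 by rewrite -v1 (bigD1 i) //= lerDl sumr_ge0.
  rewrite ler_norml /A => /andP[vN1 vi1].
  case: ifPn => [iK|iK]; first by rewrite /= in_itv /= vi1 vK.
  case: ifPn => [iS|iS]; first by rewrite /= in_itv /= vi1 vN1.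
  by rewrite /= in_itv /= v0 ?lexx // inE negb_or iK.
- move=> i; rewrite inE negb_or => /andP[iK iS].
  have := vA i; rewrite /A (negPf iK) (negPf iS) /= in_itv /=.
  by move=> ?; apply/eqP; rewrite eq_le andbC.
- by move=> i iK; have := vA i; rewrite /A iK /= in_itv /= => /andP[].
Qed.

(** At [q0] the norm of the combination does not vanish on the compact set of normalized
    multipliers. Joint continuity and compactness give a positive lower bound there that persists
    for [q] near [q0]; homogeneity then removes the normalization. *)
Lemma pos_indep_bound (T : topologicalType) (g : 'I_p -> T -> 'rV[R]_m)
    (q0 : T) K S : (forall i, {for q0, continuous (g i)}) ->
  [disjoint K & S]%B -> ~ pos_lin_dep (g ^~ q0) K (g ^~ q0) S ->
  \forall q \near q0 & c \near 0^'+, forall lam : 'I_p -> R,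
    (forall i, i \notin K :|: S -> lam i = 0) ->
    (forall i, i \in K -> 0 <= lam i) ->
    c * \sum_i `|lam i| <= `|\sum_i lam i *: g i q|.
Proof.
move=> gc KS indep.
pose P (qc : T * R) (lam : 'rV[R]_p) :=
  qc.2 <= `|\sum_i lam 0 i *: g i qc.1|.
have PA := (compact_near_coveringP _).1 (@simplex_compact K S) _
  (filter_prod (nbhs q0) (nbhs (0 : R)^'+)) P _.
have {PA} : \forall qc \near filter_prod (nbhs q0) (nbhs (0 : R)^'+),
    [set lam : 'rV[R]_p |
  [/\ forall i, i \notin K :|: S -> lam 0 i = 0,
      forall i, i \in K -> 0 <= lam 0 i & \sum_i `|lam 0 i| = 1]] `<=` P qc.
  apply: PA => lam0 [lam0S lam0K lam01].
  pose s := \sum_i lam0 0 i *: g i q0.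
  have s0 : 0 < `|s| / 2.
    rewrite divr_gt0 // normr_gt0; apply/eqP => s0; apply: indep.
    exists (lam0 0), (lam0 0); split => //; split.
      have [i i0] : exists i, lam0 0 i != 0.
        apply: contrapT => /forallNP lamN0; move: lam01; rewrite big1.
          by move/esym/eqP; rewrite oner_eq0.
        by move=> i _; have /negP/negPn/eqP -> := lamN0 i; rewrite normr0.
      have : i \in K :|: S by apply: contraNT i0 => /lam0S ->.
      by rewrite inE => /orP[iK|iS]; [left|right]; exists i.
    (* Disjointness lets the single vector [lam0] supply both the coefficients on [K] and those on
       [S]. *)
    rewrite -bigU //= -[RHS]s0 /s -(sum_supp _ lam0S).
    by apply: eq_bigl => i; rewrite !inE.
  have sc : (fun x : 'rV[R]_p * (T * R) => `|\sum_i x.1 0 i *: g i x.2.1|)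
      @ filter_prod (nbhs lam0) (filter_prod (nbhs q0) (nbhs (0 : R)^'+))
      --> `|s|.
    apply: cvg_norm; apply: cvg_sumr => i _; apply: cvgZ.
      apply: (cvg_comp (fun x : 'rV[R]_p * (T * R) => x.1) (fun v : 'rV[R]_p => v 0 i)).
        exact: cvg_fst.
      exact: coord_continuous.
    apply: (cvg_comp (fun x : 'rV[R]_p * (T * R) => x.2.1) (g i)); last exact: gc.
    apply: (cvg_comp (fun x : 'rV[R]_p * (T * R) => x.2) (fun x => x.1)).
      exact: cvg_snd.
    exact: cvg_fst.
  have c1 : \forall x \near filter_prod (nbhs lam0)
      (filter_prod (nbhs q0) (nbhs (0 : R)^'+)), x.2.2 < `|s| / 2.
    have : (fun x : 'rV[R]_p * (T * R) => x.2.2)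
      @ filter_prod (nbhs lam0) (filter_prod (nbhs q0) (nbhs (0 : R)^'+))
      --> (0 : R)^'+.
      apply: (cvg_comp (fun x : 'rV[R]_p * (T * R) => x.2) (fun x => x.2)).
        exact: cvg_snd.
      exact: cvg_snd.
    by move/(_ [set c | c < `|s| / 2]); apply; exact: nbhs_right_lt.
  have s2 : `|s| / 2 < `|s| by lra.
  apply: filterS (filterI c1 (cvgr_gt _ sc _ s2)).
  by move=> -[lam [q c]] /=; rewrite /P /= => -[c2 c3]; exact: ltW (lt_trans c2 c3).
apply: filterS => -[q c] /= Pq lam lamS lamK.
have [->|N0] := eqVneq (\sum_i `|lam i|) 0; first by rewrite mulr0.
have N_gt0 : 0 < \sum_i `|lam i| by rewrite lt_neqAle eq_sym N0 sumr_ge0.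
set N := \sum_i _ in N0 N_gt0 *.
rewrite -ler_pdivlMr //.
have /Pq : [/\ forall i, i \notin K :|: S -> (\row_j (lam j / N)) 0 i = 0,
      forall i, i \in K -> 0 <= (\row_j (lam j / N)) 0 i
    & \sum_i `|(\row_j (lam j / N)) 0 i| = 1].
  split => [i /lamS|i /lamK|].
  - by rewrite mxE => ->; rewrite mul0r.
  - by rewrite mxE => ?; rewrite divr_ge0 // ltW.
  - under eq_bigr do rewrite mxE normrM normfV (gtr0_norm N_gt0).
    by rewrite -mulr_suml divff.
rewrite /P /=; under eq_bigr do rewrite mxE mulrC -scalerA.
by rewrite -scaler_sumr normrZ normfV gtr0_norm // mulrC.
Qed.

End PositiveIndependence.

(** * Bounded multipliers under RCPLD *)

Section Multipliers.
Set Implicit Arguments. Unset Strict Implicit.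
Variables (R : realType) (n m p l : nat).
Variable h : 'I_p -> 'rV[R]_n -> 'rV[R]_m -> \bar R.
Local Notation G := (grad h).

(** The multipliers [lam] may be exchanged for bounded ones representing the same vector. The new
    ones keep the signs and charge only violated inequalities, which is what the convexity estimate
    requires; equality multipliers are free. *)
Definition multiplier_bound (c : R) (q : 'rV[R]_n * 'rV[R]_m) : Prop :=
  forall lam : 'I_p -> R,
  (forall i : 'I_p, (i < l)%N -> 0 <= lam i) ->
  (forall i : 'I_p, (i < l)%N -> lam i != 0 -> (0 < h i q.1 q.2)%E) ->
  exists lam' : 'I_p -> R,
    [/\ forall i : 'I_p, (i < l)%N -> 0 <= lam' i,
        forall i : 'I_p, (i < l)%N -> lam' i != 0 -> (0 < h i q.1 q.2)%E,
        \sum_i lam' i *: G i q.1 q.2 = \sum_i lam i *: G i q.1 q.2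
      & c * \sum_i `|lam' i| <= `|\sum_i lam i *: G i q.1 q.2|].

Lemma rankJE x y : rankJ l h x y = \rank (rowmx (G ^~ x ^~ y) (Jset p l)).
Proof.
by congr (\rank _); apply/row_matrixP => i; rewrite !rowK inE.
Qed.

(** Expand each [v j] with [j] in [T] over [S] and collect coefficients. With [T] the equality
    indices, this leaves the inequality multipliers untouched. *)
Lemma span_reduce (v : 'I_p -> 'rV[R]_m) (S T : {set 'I_p}) (lam : 'I_p -> R) :
  S \subset T ->
  (forall j, j \in T -> exists c : 'I_p -> R, v j = \sum_(i in S) c i *: v i) ->
  exists lam1 : 'I_p -> R,
    [/\ forall i, i \notin T -> lam1 i = lam i,
        forall i, i \in T -> i \notin S -> lam1 i = 0
      & \sum_i lam1 i *: v i = \sum_i lam i *: v i].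
Proof.
move=> ST vspan.
have [C vC] : exists C : 'I_p -> 'I_p -> R,
    forall j, j \in T -> v j = \sum_(i in S) C j i *: v i.
  have /choice [C vC] : forall j, exists c : 'I_p -> R,
      j \in T -> v j = \sum_(i in S) c i *: v i.
    move=> j; case: (boolP (j \in T)) => [/vspan [c ->]|jT]; first by exists c.
    by exists (fun=> 0).
  by exists C.
exists (fun i => if i \in T then
  if i \in S then \sum_(j in T) lam j * C j i else 0 else lam i); split.
- by move=> i /negPf ->.
- by move=> i -> /negPf ->.
rewrite (bigID (mem T)) [RHS](bigID (mem T)) /=; congr (_ + _); last first.
  by apply: eq_bigr => i /negPf ->.
transitivity (\sum_(i in S) (\sum_(j in T) lam j * C j i) *: v i).
  rewrite big_mkcond [RHS]big_mkcond; apply: eq_bigr => i _.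
  case: (boolP (i \in T)) => iT; case: (boolP (i \in S)) => iS;
    rewrite ?scale0r //.
  by rewrite (fintype.subsetP ST) in iT.
under [LHS]eq_bigr do rewrite scaler_suml.
rewrite exchange_big; apply: eq_bigr => j jT /=.
by rewrite [in RHS]vC // scaler_sumr; apply: eq_bigr => i _; rewrite scalerA.
Qed.

Lemma RCPLD_multiplier_bound (xbar : 'rV[R]_n) (ybar : 'rV[R]_m) :
  Gam l h xbar ybar ->
  (forall i, {for (xbar, ybar),
    continuous (fun q : 'rV[R]_n * 'rV[R]_m => h i q.1 q.2)}) ->
  (forall i, {for (xbar, ybar),
    continuous (fun q : 'rV[R]_n * 'rV[R]_m => G i q.1 q.2)}) ->
  RCPLD l h (domG l h) xbar ybar ->
  \forall q \near (xbar, ybar) & c \near 0^'+,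
    domG l h q.1 -> multiplier_bound c q.
Proof.
move=> Gy hc gc [U [S [Uq [SJ [Sbasis [rk Kdep]]]]]].
have xdom : domG l h xbar by exists ybar.
have U0 : U (xbar, ybar) by exact: nbhs_singleton.
have NU : \forall q \near (xbar, ybar) & c \near (0 : R)^'+, U q.
  exact: (cvg_fst Uq).
have Nc : \forall q \near (xbar, ybar) & c \near (0 : R)^'+, 0 < c.
  by apply: (cvg_snd (G := (0 : R)^'+)); exact: nbhs_right_gt.
have Nact : \forall q \near (xbar, ybar) & c \near (0 : R)^'+,
    forall i : 'I_p, (i < l)%N && (i \notin active l h xbar ybar) ->
      (h i q.1 q.2 < 0)%E.
  suff : \forall q \near (xbar, ybar), forall i : 'I_p,
      (i < l)%N && (i \notin active l h xbar ybar) -> (h i q.1 q.2 < 0)%E.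
    exact: cvg_fst.
  apply: (@filter_forall _ _ _ (nbhs (xbar, ybar)) _) => i.
  apply: (@filter_imply _ _ _ (nbhs (xbar, ybar)) _) => /andP[il iact].
  apply: (hc i [set z | (z < 0)%E]); apply: open_nbhs_nbhs; split.
    exact: open_ereal_lt_ereal.
  rewrite /= lt_neqAle (Gy.1 i il) andbT.
  by move: iact; rewrite inE il.
(* There are finitely many [K], so one neighborhood and one range of [c] serve them all. *)
have NK : \forall q \near (xbar, ybar) & c \near (0 : R)^'+,
    forall K : {set 'I_p}, [disjoint K & S]%B /\
      ~ pos_lin_dep (G ^~ xbar ^~ ybar) K (G ^~ xbar ^~ ybar) S ->
    forall lam : 'I_p -> R, (forall i, i \notin K :|: S -> lam i = 0) ->
      (forall i, i \in K -> 0 <= lam i) ->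
      c * \sum_i `|lam i| <= `|\sum_i lam i *: G i q.1 q.2|.
  apply: (@filter_forall _ _ _ (filter_prod _ _) _) => K.
  apply: (@filter_imply _ _ _ (filter_prod _ _) _) => -[KS Kind].
  exact: (pos_indep_bound (g := fun i q => G i q.1 q.2)).
apply: filterS (filterI (filterI NU Nc) (filterI Nact NK)).
move=> -[q c] [[/= Uqq c0] [qact qK]] qdom lam lam0 lampos.
(* For empty [K], positive-linear dependence is linear dependence of the basis [S]. *)
have S_pos_indep : ~ pos_lin_dep (G ^~ xbar ^~ ybar) finset.set0 (G ^~ xbar ^~ ybar) S.
  move=> [al [be [_ [ne0 sum0]]]]; apply: Sbasis.2.1; exists be.
  by case: ne0 => [[i]|?]; [rewrite inE|split => //; rewrite big_set0 add0r in sum0].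
(* The bound for empty [K], applied to a dependency at [q], would force all its coefficients to
   vanish. *)
have S_indep : ~ lin_dep (fun i => G i q.1 q.2) S.
  move=> /lin_depP [be [beS [i bei] sum0]].
  have d0 : [disjoint finset.set0 & S]%B by rewrite finset.disjoints_subset finset.sub0set.
  have : c * \sum_i `|be i| <= `|\sum_i be i *: G i q.1 q.2|.
    apply: (qK _ (conj d0 S_pos_indep)) => [j|j]; last by rewrite inE.
    by rewrite finset.set0U; exact: beS.
  rewrite sum0 normr0; apply/negP; rewrite -ltNge mulr_gt0 // (bigD1 i) //=.
  rewrite ltr_pwDl ?normr_gt0 //.
  by rewrite sumr_ge0.
have Uq2 : U (q.1, q.2) by rewrite -surjective_pairing.
have rkq : \rank (rowmx (G ^~ q.1 ^~ q.2) (Jset p l)) =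
    \rank (rowmx (G ^~ xbar ^~ ybar) (Jset p l)).
  by have := rk _ _ _ _ Uq2 qdom U0 xdom; rewrite !rankJE.
have Jspan := basis_of_span_const_rank Sbasis S_indep rkq.
have [lam1 [lam1I lam1J lam1sum]] := span_reduce lam SJ Jspan.
have SI (i : 'I_p) : (i < l)%N -> i \notin S.
  by move=> il; apply/negP => /(fintype.subsetP SJ); rewrite inE leqNgt il.
have IJ (i : 'I_p) : (i < l)%N -> i \notin Jset p l by rewrite inE -ltnNge.
have JJ (i : 'I_p) : (l <= i)%N -> i \in Jset p l by rewrite inE.
have lam1_ge0 i : i \notin S -> 0 <= lam1 i.
  move=> iS; have [il|il] := ltnP i l; first by rewrite (lam1I _ (IJ _ il)) lam0.
  by rewrite (lam1J _ (JJ _ il) iS).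
have [lam' [lam'0 lam'supp lam'sum lam'ind]] := caratheodory S_indep lam1_ge0.
set K := [set i | _]%SET in lam'ind.
have KI i : i \in K -> (i < l)%N && (lam i != 0).
  rewrite inE => /andP[iS /(lam'supp _ iS)].
  have [il|il] := ltnP i l; first by rewrite (lam1I _ (IJ _ il)).
  by rewrite (lam1J _ (JJ _ il) iS) eqxx.
have KS : [disjoint K & S]%B.
  by rewrite disjoint_subset; apply/fintype.subsetP => i; rewrite !inE => /andP[].
(* A multiplier in [K] is nonzero, so its constraint is violated at [q], whereas constraints
   inactive at [(xbar, ybar)] stay negative nearby. *)
have Kact : K \subset active l h xbar ybar.
  apply/fintype.subsetP => i /KI /andP[il li]; apply: contraT => iact.
  have := qact i; rewrite il iact => /(_ isT).
  by rewrite ltNge (ltW (lampos _ il li)).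
exists lam'; split.
- by move=> i /SI; exact: lam'0.
- move=> i il li; apply: (lampos i il).
  have iK : i \in K by rewrite inE (SI i il).
  by case/andP: (KI i iK).
- exact: etrans lam'sum lam1sum.
- rewrite -lam1sum -lam'sum; apply: (qK K).
  + split; first exact: KS.
    (* Contrapositive of condition (iii): independence at [q] excludes positive-linear dependence at
       [(xbar, ybar)]. *)
    move=> Kpos; apply: lam'ind.
    exact: (Kdep K Kact Kpos).
  + move=> i; rewrite !inE negb_or negb_and negbK => /andP[/orP[iS|li] iS'].
      by rewrite iS in iS'.
    exact/eqP/negPn.
  + by move=> i; rewrite inE => /andP[iS _]; exact: lam'0.
Qed.

End Multipliers.

(** * Gradients, convexity and stationarity of the penalty function *)

Section Gradients.
Set Implicit Arguments. Unset Strict Implicit.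
Variables (R : realType) (m p : nat).
Implicit Types (u v w d y z : 'rV[R]_m) (f : 'rV[R]_m -> R).

Definition dot u v : R := \sum_j u 0 j * v 0 j.

Lemma dotC u v : dot u v = dot v u.
Proof. by apply: eq_bigr => j _; rewrite mulrC. Qed.

Lemma dotDl u v w : dot (u + v) w = dot u w + dot v w.
Proof.
by rewrite -big_split; apply: eq_bigr => j _; rewrite mxE mulrDl.
Qed.

Lemma dotZl a u v : dot (a *: u) v = a * dot u v.
Proof. by rewrite mulr_sumr; apply: eq_bigr => j _; rewrite mxE mulrA. Qed.

Lemma dotNl u v : dot (- u) v = - dot u v.
Proof. by rewrite -scaleN1r dotZl mulN1r. Qed.

Lemma dot_suml (I : Type) (r : seq I) (P : pred I) (g : I -> 'rV[R]_m) v :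
  dot (\sum_(i <- r | P i) g i) v = \sum_(i <- r | P i) dot (g i) v.
Proof.
apply: (big_morph (dot^~ v)) => [u w|]; first exact: dotDl.
by rewrite /dot big1 // => j _; rewrite mxE mul0r.
Qed.

Lemma dot_ge0 u : 0 <= dot u u.
Proof. by apply: sumr_ge0 => j _; rewrite -expr2 sqr_ge0. Qed.

Lemma dot_eq0 u : dot u u <= 0 -> u = 0.
Proof.
move=> u0; have /eqP : dot u u = 0 by apply/eqP; rewrite eq_le u0 dot_ge0.
rewrite psumr_eq0 => [/allP uj|j _]; last by rewrite -expr2 sqr_ge0.
apply/rowP => j; rewrite mxE; apply/eqP.
by have := uj j (mem_index_enum _); rewrite mulf_eq0 orbb.
Qed.

Lemma dot_sqrDZ u v t :
  dot (u + t *: v) (u + t *: v) = dot u u + 2 * t * dot u v + t ^+ 2 * dot v v.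
Proof.
rewrite !(dotDl, dotZl) !(dotC _ (u + _)) !(dotDl, dotZl) (dotC v u).
by ring.
Qed.

Lemma enorm_dot u : enorm u = Num.sqrt (dot u u).
Proof. by congr Num.sqrt; apply: eq_bigr => j _; rewrite expr2. Qed.

Lemma sqr_enorm u : enorm u ^+ 2 = dot u u.
Proof. by rewrite enorm_dot sqr_sqrtr ?dot_ge0. Qed.

Lemma enorm_ge0 u : 0 <= enorm u.
Proof. exact: sqrtr_ge0. Qed.

Lemma normr_le_enorm u : `|u| <= enorm u.
Proof.
rewrite [leLHS]/Num.norm /= mx_normrE; apply: bigmax_le => [|[i j] _] /=.
  exact: enorm_ge0.
rewrite -sqrtr_sqr; apply: ler_wsqrtr; rewrite ord1 (bigD1 j) //= lerDl.
by apply: sumr_ge0 => k _; rewrite sqr_ge0.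
Qed.

Lemma enormN u : enorm (- u) = enorm u.
Proof. by rewrite !enorm_dot !(dotNl, dotC _ (- u)) opprK. Qed.

Lemma enorm_continuous y : continuous (fun z => enorm (z - y)).
Proof.
move=> z; apply: (continuous_comp (g := @Num.sqrt R)); last exact: sqrt_continuous.
apply: (cvg_sumr (F := nbhs z)) => j _.
have zc : (fun w => (w - y) 0 j) @ z --> (z - y) 0 j.
  rewrite (_ : (fun w => _) = fun w : 'rV[R]_m => w 0 j - y 0 j).
    by rewrite !mxE; apply: (@cvgB _ _ _ (nbhs z)); [exact: coord_continuous|exact: cvg_cst].
  by apply/funext => w; rewrite !mxE.
by under eq_fun do rewrite expr2; rewrite expr2; apply: cvgM.
Qed.

(* [grad h i x] is convertible to [gradf (fun z => fine (h i x z))]. *)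
Definition gradf (f : 'rV[R]_m -> R) z : 'rV[R]_m :=
  \row_j 'd f z (delta_mx 0 j).

Lemma diff_gradf f z d : 'd f z d = dot (gradf f z) d.
Proof.
rewrite [in LHS](row_sum_delta d) linear_sum; apply: eq_bigr => j _.
by rewrite linearZ mxE mulrC.
Qed.

Lemma diff_quotient_cvg f z d : differentiable f z ->
  t^-1 * (f (z + t *: d) - f z) @[t --> 0^'+] --> dot (gradf f z) d.
Proof.
move=> df; rewrite -diff_gradf -deriveE //.
have dc : (fun t : R => t^-1 *: ((f \o shift z) (t *: d) - f z)) @ 0^' -->
  'D_d f z by exact: diff_derivable.
have := cvg_dnbhs_at_right dc; apply: cvg_trans; apply: near_eq_cvg.
by near=> t; rewrite /= [z + _]addrC.
Unshelve. all: by end_near. Qed.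

(** The difference quotients at [z] towards [y] are at most [f y - f z], hence so is their limit.
    Convexity is asked only between [y] and [z], in the form that an affine function and its
    opposite both satisfy. *)
Lemma convex_grad_le f z y : differentiable f z ->
  (forall t, 0 <= t <= 1 ->
     f (t *: y + (1 - t) *: z) <= t * f y + (1 - t) * f z) ->
  dot (gradf f z) (y - z) <= f y - f z.
Proof.
move=> df fconv; rewrite leNgt; apply/negP => /(cvgr_gt _ (diff_quotient_cvg df)).
move=> lt_near.
have t1 : \forall t \near (0 : R)^'+, 0 < t < 1.
  by near=> t; apply/andP; split; near: t; [exact: nbhs_right_gt|exact: nbhs_right_lt].
have [t [/= ft /andP[t0 t1']]] := filter_ex (filterI lt_near t1).
have := fconv t; rewrite (ltW t0) (ltW t1') => /(_ isT).
rewrite (_ : t *: y + _ = z + t *: (y - z)); last first.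
  by rewrite scalerBl scale1r scalerBr addrCA addrA.
move: ft; rewrite mulrC ltr_pdivlMr // => ft ?; lra.
Unshelve. all: by end_near. Qed.

Lemma grad_oppf f z : differentiable f z -> gradf (- f) z = - gradf f z.
Proof. by move=> df; apply/rowP => j; rewrite !mxE diffN. Qed.

(** The boolean marks an inequality. Equalities keep their sign, so that [2 * viol_part s a] is the
    derivative of the square in both cases. *)
Definition viol_part (s : bool) (a : R) : R := if s then Num.max 0 a else a.

(** Second-order upper estimate of a function whose derivative is 2-Lipschitz; it avoids
    differentiating the maximum. *)
Lemma sqr_viol_part_le s a b : viol_part s b ^+ 2 <=
  viol_part s a ^+ 2 + 2 * viol_part s a * (b - a) + (b - a) ^+ 2.
Proof.
rewrite /viol_part; case: s; last by nra.
have a2 := sqr_ge0 a; have b2 := sqr_ge0 b; have ab2 := sqr_ge0 (b - a).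
case: (leP 0 a) => a0; case: (leP 0 b) => b0; try by rewrite !expr2 in a2 b2 ab2 *; lra.
have : 0 <= - a * b by rewrite mulr_ge0 ?oppr_ge0 // ltW.
by rewrite !expr2 in a2 b2 ab2 * => ?; lra.
Qed.

(** Move from [z] in the direction of the residual [d] of the claimed identity. The one-sided
    first-order change is at most [- 2 * dot d d], and minimality makes it nonnegative, so
    [d = 0]. *)
Lemma penalty_stationary (f : 'I_p -> 'rV[R]_m -> R) (s : pred 'I_p) k y z :
  0 <= k -> (forall i, differentiable (f i) z) ->
  (forall w, dot (z - y) (z - y) + k * \sum_i viol_part (s i) (f i z) ^+ 2 <=
             dot (w - y) (w - y) + k * \sum_i viol_part (s i) (f i w) ^+ 2) ->
  y - z = \sum_i (k * viol_part (s i) (f i z)) *: gradf (f i) z.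
Proof.
move=> k0 df zmin; apply/eqP; rewrite -subr_eq0; apply/eqP.
set g := \sum_i _; set d := y - z - g; apply: dot_eq0.
pose th i := viol_part (s i) (f i z).
pose r i t := t^-1 * (f i (z + t *: d) - f i z).
(* Upper bound for the increase of the penalty from [z] to [z + t *: d], divided by [t]. *)
pose Q t := 2 * dot (z - y) d + t * dot d d +
  k * \sum_i (2 * th i * r i t + t * r i t ^+ 2).
have Qcvg : Q t @[t --> 0^'+] --> 2 * dot (z - y) d + 0 * dot d d +
    k * \sum_i (2 * th i * dot (gradf (f i) z) d +
                0 * dot (gradf (f i) z) d ^+ 2).
  have t0 : (t : R) @[t --> 0^'+] --> (0 : R) by exact: cvg_at_right_filter cvg_id.
  have rc i := diff_quotient_cvg (d := d) (df i).
  apply: cvgD.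
    by apply: cvgD; [exact: cvg_cst|apply: cvgM => //; exact: cvg_cst].
  apply: cvgM; first exact: cvg_cst.
  apply: cvg_sumr => i _; apply: cvgD.
    by apply: cvgM; [exact: cvg_cst|exact: rc].
  by apply: cvgM => //; exact: cvgM (rc i) (rc i).
have Q0 t : 0 < t -> 0 <= Q t.
  move=> t0; have := zmin (z + t *: d).
  rewrite -addrAC dot_sqrDZ => zmint.
  have : \sum_i viol_part (s i) (f i (z + t *: d)) ^+ 2 <=
      \sum_i (th i ^+ 2 + t * (2 * th i * r i t + t * r i t ^+ 2)).
    apply: ler_sum => i _; apply: le_trans (sqr_viol_part_le _ (f i z) _) _.
    have -> : f i (z + t *: d) - f i z = t * r i t.
      by rewrite /r mulrA divff ?mul1r // gt_eqF.
    by rewrite -/(th i) le_eqVlt; apply/orP; left; apply/eqP; ring.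
  rewrite big_split -mulr_sumr => /(ler_wpM2l k0) thle.
  rewrite -(pmulr_rge0 _ t0) /Q.
  by move: zmint thle; rewrite -/(th _) /=; set A := \sum_i (_ + _); lra.
have : 0 <= 2 * dot (z - y) d + 0 * dot d d +
    k * \sum_i (2 * th i * dot (gradf (f i) z) d +
                0 * dot (gradf (f i) z) d ^+ 2).
  rewrite leNgt; apply/negP => /(cvgr_lt _ Qcvg) Qlt.
  have [t [/= Qt t0]] := filter_ex (filterI Qlt (nbhs_right_gt (0 : R))).
  by move: Qt; rewrite ltNge Q0.
have -> : k * \sum_i (2 * th i * dot (gradf (f i) z) d +
                0 * dot (gradf (f i) z) d ^+ 2) = 2 * dot g d.
  rewrite dot_suml !mulr_sumr; apply: eq_bigr => i _.
  by rewrite dotZl mul0r addr0 /th; ring.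
have -> : dot d d = - dot (z - y) d - dot g d.
  by rewrite -dotNl -dotNl -dotDl opprB.
by lra.
Qed.

End Gradients.

(** * From multipliers to distances *)

Section ErrorBound.
Set Implicit Arguments. Unset Strict Implicit.
Variables (R : realType) (n m p l : nat).
Variable h : 'I_p -> 'rV[R]_n -> 'rV[R]_m -> \bar R.
Local Notation H := (fun i x z => fine (h i x z)).

Definition slack (x : 'rV[R]_n) (i : 'I_p) (z : 'rV[R]_m) : R :=
  viol_part (i < l)%N (fine (h i x z)).

Lemma slack_eq0P x z : (forall i, h i x z \is a fin_num) ->
  Gam l h x z <-> forall i, slack x i z = 0.
Proof.
move=> hfin; split=> [[hI hJ] i|hs].
  rewrite /slack /viol_part; have [il|il] := ltnP i l; last by rewrite hJ.
  by apply: max_l; rewrite -lee_fin (fineK (hfin i)) hI.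
split=> i il; have := hs i; rewrite /slack /viol_part.
  by rewrite il => /max_idPl; rewrite -lee_fin (fineK (hfin i)).
by rewrite ltnNge il /= => fi; rewrite -(fineK (hfin i)) fi.
Qed.

Lemma slack_continuous x i : continuous (H i x) -> continuous (slack x i).
Proof.
rewrite /slack /viol_part => hc; case: (i < l)%N => //.
have c0 : continuous (fun _ : 'rV[R]_m => 0 : R) by exact: cst_continuous.
exact: (max_fun_continuous c0 hc).
Qed.

Lemma convex_fine x i : (forall y, h i x y \is a fin_num) -> econvex (h i x) ->
  forall y1 y2 t, 0 <= t <= 1 ->
  H i x (t *: y1 + (1 - t) *: y2) <= t * H i x y1 + (1 - t) * H i x y2.
Proof.
move=> hfin hconv y1 y2 t t01; rewrite -lee_fin fineK //.
by apply: hconv => //; rewrite fineK.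
Qed.

Lemma affine_fine x i : eaffine (h i x) -> forall y1 y2 t,
  H i x (t *: y1 + (1 - t) *: y2) = t * H i x y1 + (1 - t) * H i x y2.
Proof.
move=> [a [b hab]] y1 y2 t; rewrite !hab /=.
have -> : \sum_j a 0 j * (t *: y1 + (1 - t) *: y2) 0 j =
    \sum_j (t * (a 0 j * y1 0 j) + (1 - t) * (a 0 j * y2 0 j)).
  by apply: eq_bigr => j _; rewrite !mxE; ring.
by rewrite big_split /= -!mulr_sumr; ring.
Qed.

Lemma viol_ge x y (M : R) : viol l h x y = M%:E ->
  (forall i, h i x y \is a fin_num) ->
  [/\ 0 <= M, forall i : 'I_p, (i < l)%N -> H i x y <= M
    & forall i : 'I_p, (l <= i)%N -> `|H i x y| <= M].
Proof.
rewrite /viol => hM hfin; split.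
- by rewrite -lee_fin -hM; exact: bigmax_ge_id.
- move=> i il; rewrite -lee_fin -hM fineK //.
  by have := le_bigmax 0%E (fun i : 'I_p => if (i < l)%N then h i x y
    else `|h i x y|%E) i; rewrite il.
- move=> i il; rewrite -fine_abse // -lee_fin -hM fineK ?abse_fin_num //.
  have := le_bigmax 0%E (fun i : 'I_p => if (i < l)%N then h i x y
    else `|h i x y|%E) i; by rewrite ltnNge il.
Qed.

Lemma multiplier_dist x y z (c M : R) (lam : 'I_p -> R) :
  0 <= M -> (forall i : 'I_p, (i < l)%N -> H i x y <= M) ->
  (forall i : 'I_p, (l <= i)%N -> `|H i x y| <= M) ->
  (forall i w, h i x w \is a fin_num) ->
  (forall i : 'I_p, (i < l)%N -> econvex (h i x)) ->
  (forall i : 'I_p, (l <= i)%N -> eaffine (h i x)) ->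
  (forall i, differentiable (H i x) z) ->
  multiplier_bound l h c (x, z) ->
  (forall i : 'I_p, (i < l)%N -> 0 <= lam i) ->
  (forall i : 'I_p, (i < l)%N -> lam i != 0 -> 0 < H i x z) ->
  y - z = \sum_i lam i *: grad h i x z ->
  c * enorm (z - y) <= M + \sum_i `|slack x i z|.
Proof.
move=> M0 MI MJ hfin hconv haff df mult lam0 lampos yz.
have hpos i : (0 < h i x z)%E = (0 < H i x z) by rewrite -lte_fin fineK.
have [|lam' [lam'0 lam'pos lam'sum lam'bd]] := mult lam lam0.
  by move=> i il li; rewrite hpos; exact: lampos.
move: lam'sum lam'bd; rewrite /= -yz => lam'sum lam'bd.
set S := \sum_i `|slack x i z|.
have S0 : 0 <= S by exact: sumr_ge0.
have slackS i : `|slack x i z| <= S by rewrite /S (bigD1 i) //= lerDl sumr_ge0.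
have le i : lam' i * dot (grad h i x z) (y - z) <= `|lam' i| * (M + S).
  have [il|il] := ltnP i l.
    have [->|li] := eqVneq (lam' i) 0; first by rewrite normr0 !mul0r.
    rewrite ger0_norm ?lam'0 // ler_wpM2l ?lam'0 //.
    apply: le_trans (_ : _ <= H i x y - H i x z) _.
      by apply: convex_grad_le => // t t01; apply: convex_fine => //; exact: hconv.
    have := lam'pos i il li; rewrite hpos /= => Hz.
    by have := MI i il; lra.
  apply: le_trans (ler_norm _) _; rewrite normrM ler_wpM2l //.
  (* For an affine function the gradient inequality holds for it and for its opposite, which gives
     equality. *)
  have -> : dot (grad h i x z) (y - z) = H i x y - H i x z.
    have aff := affine_fine (haff i il).
    apply/eqP; rewrite eq_le; apply/andP; split.
      by apply: convex_grad_le => // t _; rewrite aff.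
    have : dot (gradf (- (H i x)) z) (y - z) <= - H i x y - - H i x z.
      apply: convex_grad_le; first exact: differentiableN.
      by move=> t _; rewrite !fctE aff; lra.
    by rewrite grad_oppf // dotNl; lra.
  apply: le_trans (ler_normB _ _) _; apply: lerD; first exact: MJ.
  by have := slackS i; rewrite /slack /viol_part ltnNge il.
have dist_le : dot (y - z) (y - z) <= (\sum_i `|lam' i|) * (M + S).
  rewrite -{1}lam'sum dot_suml mulr_suml; apply: ler_sum => i _.
  by rewrite dotZl.
rewrite -enormN opprB.
have [->|e0] := eqVneq (enorm (y - z)) 0; first by rewrite mulr0 addr_ge0.
have e_gt0 : 0 < enorm (y - z) by rewrite lt_neqAle eq_sym e0 enorm_ge0.
rewrite -(ler_pM2r e_gt0) -mulrA -expr2 sqr_enorm.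
(* The sign of [c] is not assumed; for [c < 0] the left side is nonpositive. *)
have [c0|c0] := leP 0 c; last first.
  apply: le_trans (_ : _ <= 0) _; first by rewrite mulr_le0_ge0 ?dot_ge0 // ltW.
  by rewrite mulr_ge0 ?enorm_ge0 // addr_ge0.
apply: le_trans (ler_wpM2l c0 dist_le) _; rewrite mulrA [leRHS]mulrC.
by rewrite ler_wpM2r ?addr_ge0 // (le_trans lam'bd) // normr_le_enorm.
Qed.

End ErrorBound.

(** * The error bound at a fixed parameter *)

Section Penalty.
Set Implicit Arguments. Unset Strict Implicit.
Variables (R : realType) (n m p l : nat).
Variable h : 'I_p -> 'rV[R]_n -> 'rV[R]_m -> \bar R.
Local Notation H := (fun i x z => fine (h i x z)).
Local Notation slack := (slack l h).

Lemma enorm_ball_compact (y : 'rV[R]_m) (r : R) :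
  compact [set z | enorm (z - y) <= r].
Proof.
apply: bounded_closed_compact; last first.
  pose f (z : 'rV[R]_m) := enorm (z - y).
  have ec : {in ~` f @^-1` [set t | t <= r], continuous f} by move=> z _; exact: enorm_continuous.
  exact: (preimage_closed ec (@closed_le _ _)).
exists (r + `|y|); split; first exact: num_real.
move=> M rM z /= zr; apply: le_trans (ltW rM).
rewrite -[z](subrK y); apply: le_trans (ler_normD _ _) _.
by rewrite lerD2r; exact: le_trans (normr_le_enorm _) zr.
Qed.

Definition penalty (x : 'rV[R]_n) (y : 'rV[R]_m) (k : R) (z : 'rV[R]_m) : R :=
  dot (z - y) (z - y) + k * \sum_i slack x i z ^+ 2.

(** Minimize over the closed ball about [y] through the feasible point [w]. Outside it the distance
    term alone exceeds the penalty at [w], where all slacks vanish. *)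
Lemma penalty_min x y w k : 0 <= k ->
  (forall i, continuous (H i x)) -> (forall i, h i x w \is a fin_num) ->
  Gam l h x w ->
  exists2 z, enorm (z - y) <= enorm (w - y) &
    forall z', penalty x y k z <= penalty x y k z'.
Proof.
move=> k0 hc wfin /(slack_eq0P l wfin) slackw.
have penw : penalty x y k w = dot (w - y) (w - y).
  by rewrite /penalty big1 ?mulr0 ?addr0 // => i _; rewrite slackw expr0n.
have penc : continuous (penalty x y k).
  move=> z; apply: (@cvgD _ _ _ (nbhs z)).
    have ec := enorm_continuous (y := y) (x := z).
    have dE u : dot (u - y) (u - y) = enorm (u - y) * enorm (u - y).
      by rewrite -sqr_enorm expr2.
    rewrite dE (_ : (fun u => _) = fun u => enorm (u - y) * enorm (u - y)).
      exact: (@cvgM _ _ (nbhs z) _ _ _ _ _ ec ec).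
    exact/funext.
  apply: (@cvgM _ _ (nbhs z)); first exact: cvg_cst.
  apply: (cvg_sumr (F := nbhs z)) => i _.
  have sc : continuous (slack x i) by exact: slack_continuous.
  exact: (@cvgM _ _ (nbhs z) _ _ _ _ _ (sc z) (sc z)).
have [||z zB zmin] := @compact_EVT_min _ _ (penalty x y k)
    [set z | enorm (z - y) <= enorm (w - y)] _ (@enorm_ball_compact y _).
- by exists w => /=.
- exact: continuous_subspaceT.
exists z; first by rewrite inE in zB.
move=> z'; have [z'B|z'B] := leP (enorm (z' - y)) (enorm (w - y)).
  by apply: zmin; rewrite inE.
apply: le_trans (zmin w _) _; first by rewrite inE /=.
rewrite penw /penalty -[leLHS]addr0; apply: lerD.
  rewrite -!sqr_enorm; apply: lerXn2r; rewrite ?nnegrE ?enorm_ge0 //.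
  exact: ltW.
by rewrite mulr_ge0 ?sumr_ge0 // => i _; rewrite sqr_ge0.
Qed.

(* If every point of the set were farther than c^-1 M from y, then for large k
   no point could minimize the penalty function: away from the set the penalty
   is too large, and near the set multiplier_dist applies. *)
Lemma error_bound x y (c : R) : 0 < c -> domG l h x ->
  (forall i w, h i x w \is a fin_num) ->
  (forall i, continuous (H i x)) ->
  (forall i : 'I_p, (i < l)%N -> econvex (h i x)) ->
  (forall i : 'I_p, (l <= i)%N -> eaffine (h i x)) ->
  (forall v, Gam l h x v -> \forall z \near v,
    (forall i, differentiable (H i x) z) /\ multiplier_bound l h c (x, z)) ->
  (Defs.edist y (Gam l h x) <= c^-1%:E * viol l h x y)%E.
Proof.
move=> c0 [w Gw] hfin hc hconv haff good.
have viol0 : (0 <= viol l h x y)%E by exact: bigmax_ge_id.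
case violM : (viol l h x y) viol0 => [M| |] // _; last first.
  by rewrite gt0_muley ?leey // lte_fin invr_gt0.
have [M0 MI MJ] := viol_ge violM (hfin ^~ y).
rewrite leNgt; apply/negP => dist_gt.
have far v : Gam l h x v -> M < c * enorm (v - y).
  move=> Gv; rewrite -ltr_pdivrMl // -lte_fin EFinM.
  by apply: lt_le_trans dist_gt _; apply: ereal_inf_lbound; exists v.
pose B := [set z | enorm (z - y) <= enorm (w - y)].
pose ismin (k : R) z := forall z', penalty x y k z <= penalty x y k z'.
have slackc i : continuous (slack x i) by exact: slack_continuous.
have nomin : \forall k \near +oo, B `<=` (fun z => ~ ismin k z).
  apply: (compact_near_coveringP B).1; first exact: enorm_ball_compact.
  move=> z0 _; have [Gz0|Gz0] := pselect (Gam l h x z0).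
    (* Near a feasible [z0] the slacks are small, so the strict inequality of [far] persists and
       contradicts the multiplier estimate at a minimizer. *)
    have Nz : \forall z \near z0, M + \sum_i `|slack x i z| < c * enorm (z - y).
      have dc : c * enorm (z - y) - \sum_i `|slack x i z| @[z --> nbhs z0] -->
          c * enorm (z0 - y) - \sum_i `|slack x i z0|.
        apply: (@cvgB _ _ _ (nbhs z0)).
          apply: (@cvgM _ _ (nbhs z0)); first exact: cvg_cst.
          exact: enorm_continuous.
        apply: (cvg_sumr (F := nbhs z0)) => i _; apply: cvg_norm.
        exact: slackc.
      have slack0 : \sum_i `|slack x i z0| = 0.
        rewrite big1 // => i _.
        by have /(slack_eq0P l (hfin^~ z0)) -> := Gz0; rewrite normr0.
      have far0 : M < c * enorm (z0 - y) - \sum_i `|slack x i z0|.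
        by rewrite slack0 subr0 far.
      by apply: filterS (cvgr_gt _ dc _ far0) => z /=; rewrite ltrBrDr.
    apply: filterS (filterI (filter_prod1 (filterI Nz (good _ Gz0)))
                            (filter_prod2 (nbhs_pinfty_ge (num_real 0)))).
    move=> [z k] [/= [Mlt [df mult]] k0] zmin; move: Mlt; apply/negP; rewrite -leNgt.
    apply: (multiplier_dist (lam := fun i => k * slack x i z)) => //.
    + by move=> i il; rewrite /slack /viol_part il mulr_ge0 // le_max lexx.
    + move=> i il; rewrite /slack /viol_part il; apply: contraR.
      by rewrite -leNgt => /max_idPl ->; rewrite mulr0.
    + exact: penalty_stationary k0 df zmin.
  (* Near an infeasible [z0] the penalty is at least [k * a], which for large [k] exceeds its value
     at [w]. *)
  have [a a0 az0] : exists2 a, 0 < a & a < \sum_i slack x i z0 ^+ 2.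
    have s0 : 0 < \sum_i slack x i z0 ^+ 2.
      rewrite lt_neqAle sumr_ge0 ?andbT => [|i _]; last exact: sqr_ge0.
      apply/eqP => s0; apply: Gz0; apply/(slack_eq0P l (hfin^~ z0)) => i.
      apply/eqP; rewrite -sqrf_eq0 eq_le sqr_ge0 andbT s0 (bigD1 i) //= lerDl.
      by apply: sumr_ge0 => j _; exact: sqr_ge0.
    by exists ((\sum_i slack x i z0 ^+ 2) / 2); lra.
  have sc : \sum_i slack x i z ^+ 2 @[z --> nbhs z0] --> \sum_i slack x i z0 ^+ 2.
    apply: (cvg_sumr (F := nbhs z0)) => i _.
    exact: (@cvgM _ _ (nbhs z0) _ _ _ _ _ (slackc i z0) (slackc i z0)).
  apply: filterS (filterI (filter_prod1 (cvgr_gt _ sc _ az0))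
    (filter_prod2 (nbhs_pinfty_gt (num_real (dot (w - y) (w - y) / a))))).
  move=> [z k] [/= az ka] zmin; have := zmin w.
  rewrite /penalty [in leRHS]big1 => [|i _]; last first.
    by have /(slack_eq0P l (hfin^~ w)) -> := Gw; rewrite expr0n.
  rewrite mulr0 addr0; apply/negP; rewrite -ltNge.
  move: ka; rewrite ltr_pdivrMr // => ka.
  have k0 : 0 < k.
    by rewrite -(pmulr_lgt0 _ a0); exact: le_lt_trans (dot_ge0 _) ka.
  apply: lt_le_trans ka _; rewrite -[leLHS]add0r lerD ?dot_ge0 //.
  by rewrite ler_wpM2l ?ltW.
have [k [kB k0]] := filter_ex (filterI nomin (nbhs_pinfty_ge (num_real 0))).
have [z zB zmin] := penalty_min y k0 hc (hfin ^~ w) Gw.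
exact: kB z zB zmin.
Qed.

End Penalty.

(** * Upper semicontinuity of the solution set *)

Section Semicontinuity.
Set Implicit Arguments. Unset Strict Implicit.
Variables (R : realType) (n m p l : nat).
Variable h : 'I_p -> 'rV[R]_n -> 'rV[R]_m -> \bar R.
Local Notation H := (fun i x z => fine (h i x z)).

Lemma Gam_compact x (M : R) : (forall i w, h i x w \is a fin_num) ->
  (forall i, continuous (H i x)) -> (forall v, Gam l h x v -> enorm v <= M) ->
  compact (Gam l h x).
Proof.
move=> hfin hc GM.
have -> : Gam l h x = [set z | enorm (z - 0) <= M] `&`
    \bigcap_(i : 'I_p) (slack l h x i @^-1` [set t | t = 0]).
  apply/seteqP; split => z.
    move=> Gz; split; first by rewrite /= subr0; exact: GM.
    by move=> i _; have /(slack_eq0P l (hfin^~ z)) := Gz; exact.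
  by move=> [_ hz]; apply/(slack_eq0P l (hfin^~ z)) => i; exact: hz.
apply: compact_closedI; first exact: enorm_ball_compact.
apply: closed_bigI => i _; apply: preimage_closed; last exact: closed_eq.
by move=> z _; exact: slack_continuous.
Qed.

(** A tube lemma: compactness of [A] merges the local radii and constants. Radii are halved because
    [z] is measured from [v], itself only near the center [v0] of the local neighborhood. *)
Lemma compact_uniform_near (A : set 'rV[R]_m) (x0 : 'rV[R]_n)
    (Q : R -> 'rV[R]_n * 'rV[R]_m -> Prop) : compact A ->
  (forall v, A v -> \forall q \near (x0, v) & c \near 0^'+, Q c q) ->
  exists c e, [/\ 0 < c, 0 < e & forall v x z, A v -> ball x0 e x ->
    ball v e z -> Q c (x, z)].
Proof.
move=> cptA QA.
have : \forall ce \near filter_prod (0 : R)^'+ (0 : R)^'+, A `<=` (fun v =>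
    forall x z, ball x0 ce.2 x -> ball v ce.2 z -> Q ce.1 (x, z)).
  apply: (compact_near_coveringP A).1 => // v0 /QA [[A1 B] /= [A1v0 B0] QAB].
  have [e0 /= e0_gt0 A1e] := (nbhs_ballP _ _).1 A1v0.
  have Nv : \forall v \near v0, ball v0 (e0 / 2) v.
    by apply: nbhsx_ballx; rewrite divr_gt0.
  have Ne : \forall e \near (0 : R)^'+, e < e0 / 2.
    by apply: nbhs_right_lt; rewrite divr_gt0.
  apply: filterS (filterI (filter_prod1 Nv) (filter_prod2
    (filterI (filter_prod1 B0) (filter_prod2 Ne)))).
  move=> [v [c e]] [/= vv0 [Bc ee0]] x z xe ze; apply: (QAB ((x, z), c)).
  split => //=; apply: A1e; split => /=.
    by apply: le_ball xe; lra.
  by apply: (ball_split vv0); apply: le_ball ze; exact: ltW.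
move=> NQ; have Npos : \forall ce \near filter_prod (0 : R)^'+ (0 : R)^'+,
    0 < ce.1 /\ 0 < ce.2.
  by apply: (filterI (filter_prod1 (nbhs_right_gt (0 : R)))
    (filter_prod2 (nbhs_right_gt (0 : R)))).
have [[c e] [/= QQ [c0 e0]]] := filter_ex (filterI NQ Npos).
by exists c, e; split => // v x z Av; exact: QQ.
Qed.

(** The feasible end [v] contributes nothing positive, so at most [1 - t] times the slack at [y]
    remains. *)
Lemma slack_segment_le x v y t i : Gam l h x v ->
  (forall w, h i x w \is a fin_num) ->
  ((i < l)%N -> econvex (h i x)) -> ((l <= i)%N -> eaffine (h i x)) ->
  0 <= t <= 1 ->
  `|slack l h x i (t *: v + (1 - t) *: y)| <= `|slack l h x i y|.
Proof.
move=> Gv hfin hconv haff t01; have /andP[t0 t1] := t01.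
rewrite /slack /viol_part; have [il|il] /= := ltnP i l.
  have fv : fine (h i x v) <= 0 by rewrite -lee_fin fineK //; exact: Gv.1.
  have m0 w : 0 <= Num.max 0 (fine (h i x w)) by rewrite le_max lexx.
  rewrite !ger0_norm // ge_max m0 /=; apply: le_trans (convex_fine hfin (hconv il) _ _ t01) _.
  have tfv : t * fine (h i x v) <= 0 by rewrite mulr_ge0_le0.
  have tfy : (1 - t) * fine (h i x y) <= (1 - t) * Num.max 0 (fine (h i x y)).
    by rewrite ler_wpM2l ?subr_ge0 // le_max lexx orbT.
  have tm : 0 <= t * Num.max 0 (fine (h i x y)) by rewrite mulr_ge0.
  by lra.
rewrite (affine_fine (haff il)) (Gv.2 i il) mulr0 add0r normrM ler_piMl //.
by rewrite ger0_norm ?subr_ge0 // gerBl.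
Qed.

(* h is not assumed jointly continuous far from the set {xbar} x Gam xbar, so a
   limit of points of Gam x need not be controlled directly; by convexity the
   segment from ybar to a far point of Gam x meets the zone where h is
   continuous. *)
Lemma Gam_upper_semicontinuous xbar ybar (e M : R) : 0 < e ->
  Gam l h xbar ybar ->
  (forall v, Gam l h xbar v -> enorm v <= M) ->
  (forall v z, Gam l h xbar v -> ball v e z -> forall i,
    h i xbar z \is a fin_num /\
    {for (xbar, z), continuous (fun q : 'rV[R]_n * 'rV[R]_m => H i q.1 q.2)}) ->
  (forall x, domG l h x -> forall i w, h i x w \is a fin_num) ->
  (forall x (i : 'I_p), ((i < l)%N -> econvex (h i x)) /\
    ((l <= i)%N -> eaffine (h i x))) ->
  \forall x \near xbar, domG l h x -> forall v, Gam l h x v ->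
    exists2 v', Gam l h xbar v' & ball v' e v.
Proof.
move=> e0 Gy GM hc hfin hconv.
have hfinbar := hfin xbar (ex_intro _ _ Gy).
pose big (x : 'rV[R]_n) (d : R) (z : 'rV[R]_m) := exists i : 'I_p,
  d < `|slack l h x i z|.
have slackc i v z : Gam l h xbar v -> ball v e z ->
    {for (xbar, z), continuous (fun q : 'rV[R]_n * 'rV[R]_m => `|slack l h q.1 i q.2|)}.
  move=> Gv vz; have hci := (hc v z Gv vz i).2.
  apply: (@cvg_norm _ _ _ (nbhs (xbar, z))).
  rewrite /slack /viol_part; case: (i < l)%N => //.
  have c0 : {for (xbar, z), continuous (fun _ : 'rV[R]_n * 'rV[R]_m => 0 : R)}.
    exact: cst_continuous.
  exact: (continuous_max c0 hci).
pose far z := forall v', Gam l h xbar v' -> ~ ball v' (e / 2) z.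
have cptK : compact [set z : 'rV[R]_m | `|z| <= M + e].
  apply: bounded_closed_compact.
    exists (M + e); split; first exact: num_real.
    by move=> r Mr z /= zM; exact: le_trans (ltW Mr).
  pose f (z : 'rV[R]_m) := `|z|.
  have fc : {in ~` f @^-1` [set t | t <= M + e], continuous f}.
    by move=> z _; exact: norm_continuous.
  exact: (preimage_closed fc (@closed_le _ _)).
(* Consider the shell of points at least [e / 2] from all of [Gam xbar] but within [3 / 4 * e] of
   some solution. None is feasible at [xbar], and [h] is continuous there, so for [x] near [xbar]
   some slack exceeds a common [d] at each of them. *)
have [[A B] /= [NA NB] AB] : \forall xd \near filter_prod (nbhs xbar) (0 : R)^'+,
    [set z : 'rV[R]_m | `|z| <= M + e] `<=` (fun z => far z ->
      (exists2 v', Gam l h xbar v' & ball v' (3 / 4 * e) z) -> big xd.1 xd.2 z).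
  apply: (compact_near_coveringP _).1 => // z0 _.
  (* If no solution is within [e] of [z0], points within [e / 4] of [z0] are outside the shell. *)
  have [[v Gv vz0]|nz0] := pselect (exists2 v, Gam l h xbar v & ball v e z0); last first.
    have Nz : \forall z \near z0, ball z0 (e / 4) z.
      by apply: nbhsx_ballx; rewrite divr_gt0.
    apply: filterS (filter_prod1 Nz) => -[z xd] /= z0z _ [v Gv vz].
    exfalso; apply: nz0; exists v => //.
    have := ball_triangle vz (ball_sym z0z); apply: le_ball; lra.
  have [Gz0|Gz0] := pselect (Gam l h xbar z0).
    have Nz : \forall z \near z0, ball z0 (e / 2) z.
      by apply: nbhsx_ballx; rewrite divr_gt0.
    by apply: filterS (filter_prod1 Nz) => -[z xd] /= z0z /(_ _ Gz0).
  have [i si] : exists i, slack l h xbar i z0 != 0.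
    apply: contrapT => /forallNP s0; apply: Gz0.
    apply/(slack_eq0P l (hfinbar^~ z0)) => i.
    by have /negP/negPn/eqP := s0 i.
  have [a a0 ai] : exists2 a, 0 < a & a < `|slack l h xbar i z0|.
    by exists (`|slack l h xbar i z0| / 2); have := normr_gt0 (slack l h xbar i z0);
      rewrite si => ?; lra.
  have sc : `|slack l h q.1 i q.2| @[q --> nbhs (xbar, z0)] -->
    `|slack l h xbar i z0| by exact: (@slackc i v z0 Gv vz0).
  have Ns : \forall q \near (xbar, z0), a < `|slack l h q.1 i q.2|.
    exact: (cvgr_gt _ sc _ ai).
  have [e1 /= e1_gt0 e1s] := (nbhs_ballP _ _).1 Ns.
  have Nz : \forall z \near z0, ball z0 e1 z by exact: nbhsx_ballx.
  have Nx : \forall x \near xbar, ball xbar e1 x by exact: nbhsx_ballx.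
  apply: filterS (filterI (filter_prod1 Nz)
    (filter_prod2 (filterI (filter_prod1 Nx) (filter_prod2 (nbhs_right_lt a0))))).
  move=> [z [x d]] [/= z0z [xx da]] _ _; exists i => /=.
  by apply: lt_trans da _; exact: (e1s (x, z)).
have [d [/= Bd d0]] := filter_ex (filterI NB (nbhs_right_gt (0 : R))).
have Nybar : \forall x \near xbar, forall i, `|slack l h x i ybar| < d.
  apply: (@filter_forall _ _ _ (nbhs xbar) _) => i.
  have sd : `|slack l h xbar i ybar| < d.
    by have /(slack_eq0P l (hfinbar^~ ybar)) -> := Gy; rewrite normr0.
  have sc : `|slack l h q.1 i q.2| @[q --> nbhs (xbar, ybar)] -->
    `|slack l h xbar i ybar| by exact: (@slackc i ybar ybar Gy (ballxx _ e0)).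
  have Ns : \forall q \near (xbar, ybar), `|slack l h q.1 i q.2| < d.
    exact: (cvgr_lt _ sc _ sd).
  have [e1 /= e1_gt0 e1s] := (nbhs_ballP _ _).1 Ns.
  apply: filterS (nbhsx_ballx xbar e1 e1_gt0) => x xx.
  by apply: (e1s (x, ybar)); split => //; exact: ballxx.
apply: filterS (filterI NA Nybar) => x [Ax sybar] xdom v Gv.
apply: contrapT => vfar.
(* Consecutive points of the subdivision are less than [e / 4] apart, so a step that starts within
   [e / 2] of a solution cannot jump over the shell. *)
pose N := Num.bound (4 * `|v - ybar| / e).
have N_gt : 4 * `|v - ybar| / e < N%:R.
  by apply: archi_boundP; rewrite divr_ge0 ?mulr_ge0 // ltW.
have N0 : 0 < N%:R :> R by apply: le_lt_trans N_gt; rewrite divr_ge0 ?mulr_ge0 // ltW.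
pose zj (j : nat) := (j%:R / N%:R) *: v + (1 - j%:R / N%:R) *: ybar.
(* Otherwise induction from [ybar], at index 0, would make [v], at index [N], near as well. *)
have [j jN [zjnear zjfar]] : exists2 j, (j < N)%N & ~ far (zj j) /\ far (zj j.+1).
  apply: contrapT => nojump.
  have near_all j : (j <= N)%N -> ~ far (zj j).
    elim: j => [_|j IH jN] zfar.
      have := zfar _ Gy; apply; rewrite /zj mul0r scale0r add0r subr0 scale1r.
      by apply: ballxx; rewrite divr_gt0.
    by apply: nojump; exists j => //; split => //; apply: IH; exact: ltnW.
  apply: (near_all N (leqnn _)) => v' Gv' vv'; apply: vfar; exists v' => //.
  move: vv'; rewrite /zj divff ?gt_eqF // scale1r subrr scale0r addr0.
  by apply: le_ball; lra.
have [v' Gv' v'z] : exists2 v', Gam l h xbar v' & ball v' (e / 2) (zj j).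
  apply: contrapT => nov; apply: zjnear => v' Gv' vv'; apply: nov.
  by exists v'.
have step : ball (zj j) (e / 4) (zj j.+1).
  rewrite -ball_normE /ball_ /= /zj.
  rewrite (_ : _ - _ = - (N%:R^-1 *: (v - ybar))); last first.
    apply/rowP => k; rewrite !mxE -natr1; field; exact: lt0r_neq0.
  rewrite normrN normrZ ger0_norm ?invr_ge0 ?ler0n // mulrC ltr_pdivrMr //.
  by move: N_gt; rewrite ltr_pdivrMr //; lra.
have v'z1 : ball v' (3 / 4 * e) (zj j.+1).
  by apply: le_ball (ball_triangle v'z step); lra.
have zK : `|zj j.+1| <= M + e.
  rewrite -[zj _](subKr v'); apply: le_trans (ler_normB _ _) _.
  apply: lerD; first exact: le_trans (normr_le_enorm _) (GM _ Gv').
  by move: v'z1; rewrite -ball_normE /ball_ /= => /ltW /le_trans; apply; lra.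
(* In the shell some slack exceeds [d], yet on the segment it is at most the slack at [ybar], which
   is below [d]. *)
have [i] := AB (x, d) (conj Ax Bd) _ zK zjfar (ex_intro2 _ _ _ Gv' v'z1).
apply/negP; rewrite -leNgt /=; apply: le_trans (ltW (sybar i)).
apply: slack_segment_le => //; [exact: hfin|exact: (hconv x i).1|
  exact: (hconv x i).2|].
by rewrite divr_ge0 ?ler0n //= ler_pdivrMr // mul1r ler_nat.
Qed.

End Semicontinuity.

Theorem theorem3p3 (R : realType) (n m p l : nat)
    (h : 'I_p -> 'rV[R]_n -> 'rV[R]_m -> \bar R) (xbar : 'rV[R]_n) :
  (l <= p)%N ->
  domG l h xbar ->
  C1y_near l h xbar ->
  (forall x, domG l h x -> forall (i : 'I_p),
     (forall y, h i x y \is a fin_num) /\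
     continuous (fun y : 'rV[R]_m => fine (h i x y))) ->
  (* (A1) *)
  (forall (x : 'rV[R]_n) (i : 'I_p),
     ((i < l)%N -> econvex (h i x)) /\ ((l <= i)%N -> eaffine (h i x))) ->
  (* (A2) *)
  locally_bounded_at l h xbar ->
  (forall ybar, Gam l h xbar ybar -> RCPLD l h (domG l h) xbar ybar) ->
  forall ybar, Gam l h xbar ybar -> Rregular l h (domG l h) xbar ybar.
Proof.
move=> _ xdom [W [Wopen [GW WC1]]] hcont hconv [B [M [BM [V [NV VB]]]]] rcpld.
move=> ybar Gybar.
have GM v : Gam l h xbar v -> enorm v <= M.
  by move=> Gv; apply/BM/(VB xbar) => //; exact: nbhs_singleton.
have cptG : compact (Gam l h xbar).
  by apply: (@Gam_compact _ _ _ _ _ h xbar M) => // i; have [] := hcont xbar xdom i.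
(* [W] is carried along so that the uniform tube also supplies continuity and differentiability of
   [h]. *)
pose Q c q := W q /\ (domG l h q.1 -> multiplier_bound l h c q).
have NQ v : Gam l h xbar v -> \forall q \near (xbar, v) & c \near 0^'+, Q c q.
  move=> Gv; have Wv := GW v Gv.
  have NW : \forall q \near (xbar, v), W q by exact: open_nbhs_nbhs.
  apply: filterS (filterI (filter_prod1 NW)
    (RCPLD_multiplier_bound Gv _ _ (rcpld v Gv))).
  - by move=> [q c] /= [].
  - by move=> i; have [_ []] := WC1 i _ Wv.
  - by move=> i; have [_ [_ []]] := WC1 i _ Wv.
have [c [e [c0 e0 Qball]]] := compact_uniform_near cptG NQ.
have e2 : 0 < e / 2 by rewrite divr_gt0.
have Nusc : \forall x \near xbar, domG l h x -> forall v, Gam l h x v ->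
    exists2 v', Gam l h xbar v' & ball v' (e / 2) v.
  apply: (Gam_upper_semicontinuous e2 Gybar GM) => // [v z Gv vz i|x xd i w].
    have ze : ball v e z by apply: le_ball vz; lra.
    have [Wz _] := Qball v xbar z Gv (ballxx _ e0) ze.
    have [hf [hc _]] := WC1 i _ Wz; split => //.
    by apply: (@fine_cvg _ _ (nbhs (xbar, z))); rewrite fineK.
  by have [] := hcont x xd i.
exists c^-1; split; first by rewrite invr_gt0.
(* Only [x] is restricted; the error bound holds for every [y]. *)
pose U x := ball xbar e x /\ (domG l h x -> forall v, Gam l h x v ->
  exists2 v', Gam l h xbar v' & ball v' (e / 2) v).
exists [set q | U q.1]; split.
  apply: (@filter_prod1 _ _ (nbhs xbar) (nbhs ybar) _ U).
  by apply: filterI => //; exact: nbhsx_ballx.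
move=> x y [/= xe usc] xd; apply: error_bound => //.
- by move=> i w; have [] := hcont x xd i.
- by move=> i; have [] := hcont x xd i.
- by move=> i; have [] := hconv x i.
- by move=> i; have [] := hconv x i.
(* Two steps of length [e / 2], from [v'] to [v] and from [v] to [z], keep [z] in the tube around
   [Gam xbar]. *)
move=> v /(usc xd)[v' Gv' v'v].
apply: filterS (nbhsx_ballx v _ e2) => z vz.
have [Wz mult] := Qball v' x z Gv' xe (ball_split v'v vz).
by split; [move=> i; have [_ [_ []]] := WC1 i _ Wz|exact: mult].
Qed.
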